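(* Let $(W,S)$ be a Coxeter system (not necessarily finite). If $X\subseteq W$ is ascent-compatible, then the linear operators $\pi_s$ ($s\in S$) on $\mathbb C X$ define an action of the $0$-Hecke algebra $H_W(0)$ on $\mathbb C X$; that is, $\pi_s^2=-\pi_s$ for all $s\in S$ and $[\pi_s\vert\pi_t]_{m(s,t)}=[\pi_t\vert\pi_s]_{m(s,t)}$ for all distinct $s,t\in S$ with $m(s,t)<\infty$.
   Context: For a Coxeter system $(W,S)$, $m(s,t)\in\{2,3,\dots\}\cup\{\infty\}$ is the order of $st$, and for symbols $\gamma,\delta$ and $r\ge 0$, $[\gamma\vert\delta]_r$ denotes the alternating word $\cdots\gamma\delta$ of length $r$ ending in $\delta$. The $0$-Hecke algebra $H_W(0)$ is the $\mathbb C$-algebra with generators $\pi_s$ ($s\in S$) subject to $\pi_s^2=-\pi_s$ and $[\pi_s\vert\pi_t]_{m(s,t)}=[\pi_t\vert\pi_s]_{m(s,t)}$ for distinct $s,t$ with $m(s,t)<\infty$. $\ell$ is the Coxeter length; $s\in S$ is a (left) descent of $w$ if $\ell(sw)<\ell(w)$ and an ascent otherwise; $\mathrm{Des}(w)$ is the set of descents. For $X\subseteq W$, $\mathbb CX$ is the complex vector space with basis $X$, and for $s\in S$ the operator $\pi_s$ on $\mathbb CX$ is defined on $x\in X$ by $\pi_s(x)=-x$ if $s\in\mathrm{Des}(x)$; $\pi_s(x)=0$ if $s\notin\mathrm{Des}(x)$ and $sx\notin X$; $\pi_s(x)=sx$ if $s\notin\mathrm{Des}(x)$ and $sx\in X$.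 A quadruple $(u,v,s,t)$ with $u,v\in W$, $s,t\in S$ is aligned if $s$ is an ascent of $u$, $t$ is an ascent of $v$, and $u^{-1}su=v^{-1}tv$. The set $X$ is ascent-compatible if for all $u,v\in X$ and $s,t\in S$ with $(u,v,s,t)$ aligned, $su\in X$ if and only if $tv\in X$. *)

(* Defs.v *)
From HB Require Import structures.
From mathcomp Require Import all_boot all_order all_algebra.
From mathcomp Require Import finmap.
From mathcomp Require Import boolp classical_sets reals.
From mathcomp Require Import complex.
From mathcomp Require Import monalg.

Set Implicit Arguments.
Unset Strict Implicit.
Unset Printing Implicit Defensive.

Import GRing.Theory.

Local Open Scope classical_set_scope.
Local Open Scope group_scope.

Section Coxeter.
Variables (W : groupType) (S : set W).

Definition has_order (G : groupType) (g : G) (n : nat) : Prop :=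
  [/\ (0 < n)%N, g ^+ n = 1 & forall k, (0 < k < n)%N -> g ^+ k <> 1].

(* [w] is a product of [n] elements of [S].  Inverses of letters are not needed,
   since the elements of [S] will be involutions. *)
Definition word_of_size (w : W) (n : nat) : Prop :=
  exists l : seq W,
    [/\ forall s, s \in l -> S s, size l = n & \prod_(s <- l) s = w].

(* m(s,t) is the order of [s * t], and m(s,t) = oo when no [n] satisfies
   [has_order (s * t) n].  [coxeter_ext] is the universal property of the
   presentation < S | (s t)^m(s,t) = 1 for m(s,t) < oo >; uniqueness of the
   extension [g] follows from [coxeter_gen]. *)
Record coxeter_system : Prop := CoxeterSystem {
  coxeter_invol : forall s, S s -> has_order s 2;
  coxeter_gen : forall w, exists n, word_of_size w n;
  coxeter_ext : forall (G : groupType) (f : W -> G),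
    (forall s t m, S s -> S t -> has_order (s * t) m -> (f s * f t) ^+ m = 1) ->
    exists g : {multiplicative W -> G}, forall s, S s -> g s = f s
}.

(* Takes the junk value 0 outside the subgroup generated by [S]. *)
Definition cox_length (w : W) : nat :=
  if pselect (exists n, `[< word_of_size w n >]) is left e then ex_minn e else 0.

Definition Des (w : W) : set W :=
  [set s | S s /\ (cox_length (s * w) < cox_length w)%N].

Definition ascent (w s : W) : Prop := S s /\ ~ Des w s.

Definition aligned (u v s t : W) : Prop :=
  [/\ ascent u s, ascent v t & u^-1 * s * u = v^-1 * t * v].

Definition ascent_compatible (X : set W) : Prop :=
  forall u v s t, X u -> X v -> S s -> S t -> aligned u v s t ->
    (X (s * u) <-> X (t * v)).

End Coxeter.

(* The word [c|d]_r, whose rightmost letter is [d]. *)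
Fixpoint alternating (T : Type) (c d : T) (r : nat) : seq T :=
  if r is r'.+1 then rcons (alternating d c r') d else [::].

(* [word_op T [:: a; b; c] v = T a (T b (T c v))] *)
Definition word_op (I V : Type) (T : I -> V -> V) (l : seq I) (v : V) : V :=
  foldr T v l.

Local Open Scope ring_scope.

(* An action of H_W(0), given by the operators of its generators.  Only the
   values [T s] with [S s] matter. *)
Definition hecke0_action (W : groupType) (S : set W) (K : nzRingType)
    (V : lmodType K) (T : W -> {linear V -> V}) : Prop :=
  (forall s, S s -> forall v, T s (T s v) = - T s v) /\
  (forall s t m, S s -> S t -> s <> t -> has_order (s * t)%g m ->
     forall v, word_op T (alternating s t m) v = word_op T (alternating t s m) v).

Section Operators.
Variables (W : groupType) (S X : set W) (R : realType).

(* The complex vector space with basis [X]; [<< x >>] is the basis vector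
   attached to [x]. *)
Local Notation CX := {malg R[i][set_type X]}.

Definition pi_basis (s : W) (x : set_type X) : CX :=
  if `[< Des S (val x) s >] then - << x >>
  else if insub (s * val x)%g is Some y then << y >> else 0.

Definition pi_op (s : W) (g : CX) : CX :=
  \sum_(x <- msupp g) g@_x *: pi_basis s x.

Fact pi_op_is_linear (s : W) : linear (pi_op s).
Proof.
move=> a g h.
pose d := (msupp g `|` msupp h `|` msupp (a *: g + h))%fset.
have pi_opEw (k : CX) : (msupp k `<=` d)%fset ->
    pi_op s k = \sum_(x <- d) k@_x *: pi_basis s x.
  move=> kd; rewrite /pi_op; apply: big_fset_incl => // x _ xk.
  by rewrite mcoeff_outdom // scale0r.
rewrite !pi_opEw; first last;
  try by apply/fsubsetP => x kx; rewrite !in_fsetU kx ?orbT.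
rewrite scaler_sumr -big_split /=; apply: eq_bigr => x _.
by rewrite mcoeffD mcoeffZ scalerDl scalerA.
Qed.

HB.instance Definition _ (s : W) :=
  GRing.isLinear.Build R[i] CX CX *:%R (pi_op s) (pi_op_is_linear s).

Lemma pi_opU (s : W) (x : set_type X) : pi_op s << x >> = pi_basis s x.
Proof. by rewrite /pi_op msuppU oner_eq0 big_seq_fset1 mcoeffUU scale1r. Qed.

End Operators.

(* Main.v *)
(* Send each generator s to the pair (s, {s}) in the semidirect product of W with
   its power set. The reflections met along (s t)^m(s,t) each occur twice, so the
   universal property of W extends this map, and the second component of the image
   of w is its inversion set N(w); s is a left descent of w iff w^-1 s w is in N(w),
   by the exchange argument. Hence a coset <s, t> x with m = m(s,t) finite is a
   2m-gon: from an element d without inversions in d^-1 <s, t> d, two sides of m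
   ascents each climb to a common top, where s and t are both descents. Strictly
   above the bottom, the two words of length m in the pi's do the same thing: climb
   to the top (or vanish on leaving X) and pick up the same number of signs. At the
   bottom d they climb along different sides; opposite edges carry the same
   reflection, so ascent-compatibility makes one side stay in X iff the other
   does. *)

Require Import Defs.
From HB Require Import structures.
From mathcomp Require Import all_boot all_algebra.
From mathcomp Require Import boolp classical_sets reals.
From mathcomp Require Import complex.
From mathcomp Require Import monalg.
From mathcomp Require Import zify.

Set Implicit Arguments.
Unset Strict Implicit.
Unset Printing Implicit Defensive.

Import GRing.Theory.

(** * The semidirect product of W with its power set, and the relations among the images of the
    generators *)

Section ReflectionGroup.
Local Open Scope group_scope.
Variable W : groupType.

(* The semidirect product of [W] with the group of sets of elements of [W] under
   symmetric difference, on which [W] acts by conjugation. *)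
Definition wreath : Type := W * (W -> bool).
HB.instance Definition _ := gen_eqMixin wreath.
HB.instance Definition _ := gen_choiceMixin wreath.

Implicit Types p q : wreath.

Definition wreath_one : wreath := (1, fun=> false).
(** The set component of a product is N_q + q^-1 N_p q, with + the symmetric difference: the law
    obeyed by inversion sets. *)
Definition wreath_mul p q : wreath :=
  (p.1 * q.1, fun r => q.2 r (+) p.2 (q.1 * r * q.1^-1)).
Definition wreath_inv p : wreath := (p.1^-1, fun r => p.2 (p.1^-1 * r * p.1)).

Fact wreath_mulA : associative wreath_mul.
Proof.
move=> p q u; congr pair; rewrite /= ?mulgA //.
by apply/funext => r; rewrite /= addbA invgM !mulgA.
Qed.

Fact wreath_mul1 : left_id wreath_one wreath_mul.
Proof.
case=> w N; congr pair; rewrite /= ?mul1g //.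
by apply/funext => r; rewrite /= addbF.
Qed.

Fact wreath_mulr1 : right_id wreath_one wreath_mul.
Proof.
case=> w N; congr pair; rewrite /= ?mulg1 //.
by apply/funext => r; rewrite /= mul1g invg1 mulg1.
Qed.

Fact wreath_mulV : left_inverse wreath_one wreath_inv wreath_mul.
Proof.
case=> w N; congr pair; rewrite /= ?mulVg //.
by apply/funext => r; rewrite /= !mulgA mulVg mul1g mulgVK addbb.
Qed.

Fact wreath_mulrV : right_inverse wreath_one wreath_inv wreath_mul.
Proof.
case=> w N; congr pair; rewrite /= ?mulgV //.
by apply/funext => r; rewrite /= invgK addbb.
Qed.

HB.instance Definition _ := isGroup.Build wreath
  wreath_mulA wreath_mul1 wreath_mulr1 wreath_mulV wreath_mulrV.

Lemma wreath_mulE p q :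
  p * q = (p.1 * q.1, fun r => q.2 r (+) p.2 (q.1 * r * q.1^-1)) :> wreath.
Proof. by []. Qed.

Definition flip (s : W) : wreath := (s, fun r => r == s).

Lemma conj_eq (w r x : W) : (w * r * w^-1 == x) = (r == w^-1 * x * w).
Proof.
by apply/eqP/eqP => [<-|->]; rewrite !mulgA ?mulVg ?mulgV mul1g ?mulgVK ?mulgK.
Qed.

(** The elements [(t * s) ^+ j * t] are the reflections met along the word of length 2k, read from
    the right, counted modulo 2. *)
Lemma flip_expg (s t : W) k : s * s = 1 -> t * t = 1 ->
  (flip s * flip t) ^+ k = ((s * t) ^+ k,
     fun r => \big[addb/false]_(j < k.*2) (r == (t * s) ^+ j * t)) :> wreath.
Proof.
move=> ss tt; have sV : s^-1 = s by apply: mulg1_eq.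
have tV : t^-1 = t by apply: mulg1_eq.
elim: k => [|k IH].
  by rewrite expg0; congr pair; apply/funext => r; rewrite big_ord0.
rewrite expgSr IH !wreath_mulE expgSr; congr pair; apply/funext => r /=.
(* The last factor supplies the terms of index 0 and 1; conjugation by [s * t] moves the older terms
   up by two. *)
rewrite doubleS !big_ord_recl addbA; congr (_ (+) _).
  by rewrite conj_eq expg0 expg1 mul1g tV.
apply: eq_bigr => j _; rewrite conj_eq invgM sV tV.
by rewrite !lift0 expgSr expgS !mulgA.
Qed.

(** As [(t * s) ^+ m = 1], the reflections of index j and m + j coincide and cancel. *)
Lemma flip_relation (s t : W) m : s * s = 1 -> t * t = 1 ->
  (s * t) ^+ m = 1 -> (flip s * flip t) ^+ m = 1.
Proof.
move=> ss tt st1; rewrite flip_expg // st1; congr pair; apply/funext => r.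
have ts1 : (t * s) ^+ m = 1.
  have <- : (s * t)^-1 = t * s by rewrite invgM (mulg1_eq ss) (mulg1_eq tt).
  by rewrite expVgn st1 invg1.
rewrite -addnn big_split_ord /=.
by under [X in _ (+) X]eq_bigr => j _ do rewrite expgnDr ts1 mul1g; rewrite addbb.
Qed.

End ReflectionGroup.

(** * Inversion sets, the exchange argument and descents *)

Section Inversions.
Local Open Scope group_scope.
Variables (W : groupType) (S : set W).
Hypothesis coxS : coxeter_system S.

Lemma gen_mulss s : S s -> s * s = 1.
Proof. by move=> /(coxeter_invol coxS) []. Qed.

Lemma gen_mulKg s w : S s -> s * (s * w) = w.
Proof. by move=> Ss; rewrite mulgA gen_mulss // mul1g. Qed.

(** [n w] is the indicator of N(w), the set component of the extension of [flip]. The group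
    component is the identity of W, so the product law becomes the cocycle rule. *)
Lemma inversion_cocycle : exists n : W -> W -> bool,
  (forall r, n 1 r = false) /\
  (forall s w r, S s -> n (s * w) r = n w r (+) (w * r * w^-1 == s)).
Proof.
have rel s t m : S s -> S t -> has_order (s * t) m ->
    (flip s * flip t) ^+ m = 1.
  by move=> Ss St [_ st1 _]; apply: flip_relation st1; apply: gen_mulss.
have [g gS] := coxeter_ext coxS rel.
have g1 : g 1 = 1 by apply: (mulgI (g 1)); rewrite -gmulfM !mulg1.
have gw w : (g w).1 = w.
  have [k [l [lS _ <-]]] := coxeter_gen coxS w.
  elim: l lS => [|s l IH] lS; first by rewrite big_nil g1.
  rewrite big_cons gmulfM wreath_mulE /= gS ?IH //.
    by move=> x xl; apply: lS; rewrite inE xl orbT.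
  by apply: lS; rewrite inE eqxx.
exists (fun w => (g w).2); split=> [r|s w r Ss]; first by rewrite g1.
by rewrite gmulfM wreath_mulE /= gw (gS _ Ss).
Qed.

Lemma cox_length_le (l : seq W) : (forall s, s \in l -> S s) ->
  (cox_length S (\prod_(s <- l) s) <= size l)%N.
Proof.
move=> lS; rewrite /cox_length; case: pselect => // e.
by case: ex_minnP => k _; apply; apply/asboolP; exists l.
Qed.

Lemma cox_length_word w : exists l : seq W, [/\ forall s, s \in l -> S s,
  size l = cox_length S w & \prod_(s <- l) s = w].
Proof.
rewrite /cox_length; case: pselect => [e|[]]; last first.
  by have [k wk] := coxeter_gen coxS w; exists k; apply/asboolP.
by case: ex_minnP => k /asboolP wk _.
Qed.

Variable n : W -> W -> bool.
Hypothesis n1 : forall r, n 1 r = false.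
Hypothesis nM : forall s w r, S s -> n (s * w) r = n w r (+) (w * r * w^-1 == s).

(** If r is not an inversion of the tail, the cocycle rule makes it the first letter conjugated by
    the tail, and multiplying by r deletes that letter. *)
Lemma exchange (l : seq W) r : (forall s, s \in l -> S s) ->
  n (\prod_(s <- l) s) r ->
  exists l' : seq W, [/\ forall s, s \in l' -> S s, (size l' < size l)%N &
    \prod_(s <- l') s = \prod_(s <- l) s * r].
Proof.
elim: l => [|s l IH] lS; first by rewrite big_nil n1.
have Ss : S s by apply: lS; rewrite inE eqxx.
have lS' x : x \in l -> S x by move=> xl; apply: lS; rewrite inE xl orbT.
rewrite !big_cons nM //; case nlr: (n _ r) => /=.
  have [l' [l'S l'l l'r]] := IH lS' nlr; exists (s :: l').
  split=> //= [x|]; first by rewrite inE => /predU1P[->//|/l'S].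
  by rewrite big_cons l'r mulgA.
rewrite conj_eq => /eqP ->; exists l; split => //.
by rewrite !mulgA mulgK gen_mulss // mul1g.
Qed.

Lemma inversion_length w r : n w r -> (cox_length S (w * r) < cox_length S w)%N.
Proof.
have [l [lS <- <-]] := cox_length_word w => /exchange [//|l' [l'S ll' <-]].
exact: leq_ltn_trans (cox_length_le l'S) ll'.
Qed.

Lemma Des_inversion w s : S s -> Des S w s <-> n w (w^-1 * s * w).
Proof.
move=> Ss; split=> [[_ sw]|nw]; last first.
  by split=> //; have := inversion_length nw; rewrite !mulgA mulgV mul1g.
(* A reflection [w^-1 * s * w] that is not an inversion of w is one of [s * w], so w is the shorter
   of the two. *)
apply: contraPT sw => nw; apply/negP; rewrite -leqNgt ltnW //.
have : n (s * w) (w^-1 * s * w).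
  by rewrite nM // (negPf nw) !mulgA mulgV mul1g mulgK eqxx.
by move=> /inversion_length; rewrite !mulgA mulgK gen_mulss // mul1g.
Qed.

Lemma inversion_DesM w s : S s -> Des S (s * w) s <-> ~ Des S w s.
Proof.
move=> Ss; rewrite !Des_inversion //.
have -> : (s * w)^-1 * s * (s * w) = w^-1 * s * w.
  by rewrite invgM (mulg1_eq (gen_mulss Ss)) -!mulgA gen_mulKg.
by rewrite nM // !mulgA mulgV mul1g mulgK eqxx addbT; split=> /negP.
Qed.

End Inversions.

Lemma DesM (W : groupType) (S : set W) (w s : W) : coxeter_system S -> S s ->
  Des S (s * w)%g s <-> ~ Des S w s.
Proof.
by move=> coxS; have [n [n1 nM]] := inversion_cocycle coxS; exact: (inversion_DesM coxS n1 nM).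
Qed.

(** * Alternating products in a dihedral group *)

Section Chain.
Local Open Scope group_scope.
Variable W : groupType.
Implicit Types s t d : W.

(** The label of the edge from height i to height i + 1 on the side that starts with s; [chain]
    gives the vertices of that side. *)
Definition letter s t i := if odd i then t else s.

Fixpoint chain s t d i :=
  if i is i'.+1 then letter s t i' * chain s t d i' else d.

Lemma letterS s t i : letter s t i.+1 = letter t s i.
Proof. by rewrite /letter /=; case: odd. Qed.

Lemma chainSr s t d i : chain s t d i.+1 = chain t s (s * d) i.
Proof. by elim: i => //= i <-; rewrite letterS. Qed.

Lemma mulg_expgC s t k : s * (t * s) ^+ k = (s * t) ^+ k * s.
Proof.
elim: k => [|k IH]; first by rewrite mulg1 mul1g.
by rewrite expgSr mulgA IH expgSr !mulgA.
Qed.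

Section Involutions.
Variables s t : W.
Hypotheses (ss : s * s = 1) (tt : t * t = 1).

Lemma mulg_gensV : t * s = (s * t)^-1.
Proof. by rewrite invgM (mulg1_eq ss) (mulg1_eq tt). Qed.

Lemma expg_reflection k : ((s * t) ^+ k * s) * ((s * t) ^+ k * s) = 1.
Proof.
rewrite -[X in _ * X = _]mulg_expgC mulgA -(mulgA _ s s) ss mulg1.
by rewrite mulg_gensV expVgn mulgV.
Qed.

(** Vertices of equal height on the two sides differ by a rotation. At height m it is trivial once
    [(s * t) ^+ m = 1], and the sides meet. *)
Lemma chain_swap d i :
  chain s t d i = (if odd i then (s * t) ^+ i else (t * s) ^+ i) * chain t s d i.
Proof.
elim: i => [|i IH] /=; first by rewrite mul1g.
rewrite IH /letter; case: (odd i) => /=.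
  by rewrite !mulgA mulg_expgC expgSr !mulgA -(mulgA _ s s) ss mulg1.
by rewrite !mulgA mulg_expgC expgSr !mulgA -(mulgA _ t t) tt mulg1.
Qed.

Lemma expgC1 m : (s * t) ^+ m = 1 -> (t * s) ^+ m = 1.
Proof. by rewrite mulg_gensV expVgn => ->; rewrite invg1. Qed.

Lemma chain_top d m : (s * t) ^+ m = 1 -> chain s t d m = chain t s d m.
Proof. by move=> st1; rewrite chain_swap st1 expgC1 // if_same mul1g. Qed.

(** Palindromes of lengths 2i + 1 and 2(m - 1 - i) + 1: the lengths add up to 2m, a full turn,
    whence the index [m.-1 - i]. *)
Lemma expg_reflection_swap m i : (s * t) ^+ m = 1 -> (i < m)%N ->
  (s * t) ^+ i * s = (t * s) ^+ (m.-1 - i) * t.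
Proof.
case: m => // m st1 im; apply: (mulgI ((s * t) ^+ (m - i))).
rewrite mulgA -expgnDr subnK // mulg_gensV expVgn mulgA mulgV mul1g.
by apply: (mulIg t); rewrite -mulgA -expgSr st1 tt.
Qed.

End Involutions.

(** The induction peels off the edge at the bottom, which exchanges s and t and lengthens the
    palindrome at both ends. *)
Lemma chain_reflection s t d i : s * s = 1 -> t * t = 1 ->
  (chain s t d i)^-1 * letter s t i * chain s t d i =
  d^-1 * ((s * t) ^+ i * s) * d.
Proof.
move=> ss tt; elim: i s t d ss tt => [|i IH] s t d ss tt.
  by rewrite /= mul1g.
rewrite chainSr letterS IH // invgM (mulg1_eq ss) -(mulg_expgC s t i.+1).
by rewrite expgSr !mulgA.
Qed.

End Chain.

(** * Cosets of a dihedral subgroup as polygons *)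

Section Coset.
Local Open Scope group_scope.
Variables (W : groupType) (S : set W).
Hypothesis coxS : coxeter_system S.
Implicit Types s t d x : W.

(* The boundary of the 2m-gon <s, t> d, read upwards from its bottom [d] along
   both sides; edges on opposite sides carry the same reflection. *)
Record coset_polygon s t d m : Prop := CosetPolygon {
  polygon_left : S s;
  polygon_right : S t;
  polygon_gt0 : (0 < m)%N;
  polygon_top : chain s t d m = chain t s d m;
  polygon_ascl : forall i, (i < m)%N -> ~ Des S (chain s t d i) (letter s t i);
  polygon_ascr : forall i, (i < m)%N -> ~ Des S (chain t s d i) (letter t s i);
  polygon_refl : forall i, (i < m)%N ->
    (chain s t d i)^-1 * letter s t i * chain s t d i =
    (chain t s d (m.-1 - i))^-1 * letter t s (m.-1 - i) * chain t s d (m.-1 - i)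
}.

Lemma coset_polygonC s t d m : coset_polygon s t d m -> coset_polygon t s d m.
Proof.
case=> Ss St m0 top al ar re; split=> // i im.
by rewrite re ?subKn //; case: m im {m0 top al ar re} => //= m; lia.
Qed.

Lemma letter_gen s t i : S s -> S t -> S (letter s t i).
Proof. by rewrite /letter; case: odd. Qed.

Section Minimal.
Variable n : W -> W -> bool.
Hypothesis n1 : forall r, n 1 r = false.
Hypothesis nM : forall s w r, S s -> n (s * w) r = n w r (+) (w * r * w^-1 == s).

(** The reflections [(s * t) ^+ j * s] and [(t * s) ^+ j * t] together are all those of <s, t>; a
    bottom satisfies the condition in both orders. *)
Definition no_inversion s t d :=
  forall j, n d (d^-1 * ((s * t) ^+ j * s) * d) = false.

(** An inversion in the conjugated subgroup yields a shorter element of <s, t> x. Membership in the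
    coset is phrased as an induction principle over left multiplication by s and t. *)
Lemma shorten_in_coset s t x : S s -> S t -> ~ no_inversion s t x ->
  exists2 x', (cox_length S x' < cox_length S x)%N &
  forall Q : W -> Prop, (forall y, Q y -> Q (s * y)) ->
    (forall y, Q y -> Q (t * y)) -> Q x' -> Q x.
Proof.
move=> Ss St /existsNP[j /eqP]; rewrite eqbF_neg negbK => nj.
exists ((s * t) ^+ j * s * x).
  by have := inversion_length coxS n1 nM nj; rewrite !mulgA mulgV mul1g.
move=> Q Qs Qt Qx'.
have Q_refl y k : Q y -> Q ((s * t) ^+ k * s * y).
  move=> Qy; elim: k => [|k IH]; first by rewrite mul1g; apply: Qs.
  by rewrite expgS -!mulgA; apply/Qs/Qt; rewrite mulgA.
have <- : (s * t) ^+ j * s * ((s * t) ^+ j * s * x) = x; last exact: Q_refl.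
rewrite mulgA expg_reflection ?mul1g //; exact: (gen_mulss coxS).
Qed.

Lemma coset_min s t x : S s -> S t ->
  exists d, [/\ no_inversion s t d, no_inversion t s d &
  forall Q : W -> Prop, (forall y, Q y -> Q (s * y)) ->
    (forall y, Q y -> Q (t * y)) -> Q d -> Q x].
Proof.
move=> Ss St; have [k] := ubnP (cox_length S x).
elim: k x => // k IH x xk.
have [minl|/(shorten_in_coset Ss St)[x' lx' Qx']] := pselect (no_inversion s t x).
  have [minr|/(shorten_in_coset St Ss)[x' lx' Qx']] :=
    pselect (no_inversion t s x); first by exists x.
  have [|d [dl dr Qd]] := IH x'; first exact: leq_trans lx' xk.
  by exists d; split=> // Q Qs Qt /Qd -/(_ Qs Qt); apply: Qx'.
have [|d [dl dr Qd]] := IH x'; first exact: leq_trans lx' xk.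
by exists d; split=> // Q Qs Qt /Qd -/(_ Qs Qt); apply: Qx'.
Qed.

(** Each edge toggles only its own reflection, and the edges below height k carry reflections other
    than the k-th, because m is the exact order of [s * t]. *)
Lemma chain_inversion s t d m i k : S s -> S t -> has_order (s * t) m ->
  (i <= k < m)%N ->
  n (chain s t d i) (d^-1 * ((s * t) ^+ k * s) * d) =
  n d (d^-1 * ((s * t) ^+ k * s) * d).
Proof.
move=> Ss St [m0 st1 ord]; elim: i => // i IH /andP[ik km].
rewrite /= nM ?IH ?(ltnW ik) //; last exact: letter_gen.
rewrite conj_eq chain_reflection; try exact: (gen_mulss coxS).
case: eqP; rewrite ?addbF // => /mulIg/mulgI/mulIg E.
have [] := ord (k - i)%N; first by lia.
by apply: (mulgI ((s * t) ^+ i)); rewrite -expgnDr subnKC ?mulg1 // ltnW.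
Qed.

Lemma chain_asc s t d m i : S s -> S t -> has_order (s * t) m ->
  no_inversion s t d -> (i < m)%N -> ~ Des S (chain s t d i) (letter s t i).
Proof.
move=> Ss St ord min im.
rewrite (Des_inversion coxS n1 nM); last exact: letter_gen.
rewrite chain_reflection; try exact: (gen_mulss coxS).
by rewrite (chain_inversion _ _ _ ord) ?leqnn // min.
Qed.

End Minimal.

Definition on_polygon s t d m x :=
  exists2 i, (i <= m)%N & x = chain s t d i \/ x = chain t s d i.

Lemma on_polygonC s t d m x : on_polygon s t d m x <-> on_polygon t s d m x.
Proof. by split=> -[i im xi]; exists i => //; apply/or_comm. Qed.

(** Every vertex has an edge labelled s. It leads up or down the same side, except that at the top
    it may descend the other side and at the bottom it starts the side of s. *)
Lemma on_polygonM s t d m x : coset_polygon s t d m ->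
  on_polygon s t d m x -> on_polygon s t d m (s * x).
Proof.
move=> [Ss St m0 top _ _ _] [i im xE].
have up a b j y : (j <= m)%N -> y = chain a b d j -> letter a b j = s ->
    chain a b d m = chain b a d m -> (j == m -> letter b a j.-1 = s) ->
    exists2 k, (k <= m)%N & s * y = chain a b d k \/ s * y = chain b a d k.
  move=> jm -> sj tp js; have [jm'|] := ltnP j m.
    by exists j.+1 => //; left; rewrite /= sj.
  move=> mj; have {mj jm}-E : j = m by apply/eqP; rewrite eqn_leq jm.
  exists m.-1; first exact: leq_pred.
  right; rewrite E tp -{1}(prednK m0) /= -E js ?E //.
  by rewrite (gen_mulKg coxS).
have down a b j y : (0 < j <= m)%N -> y = chain a b d j -> letter a b j.-1 = s ->
    exists2 k, (k <= m)%N & s * y = chain a b d k \/ s * y = chain b a d k.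
  case: j => // j /= jm -> ->; exists j; first exact: ltnW.
  by left; rewrite (gen_mulKg coxS).
case oi: (odd i).
  case: xE => xE.
    apply: down xE _; first by rewrite im; case: i oi {im}.
    by case: i oi {im} => //= i; rewrite /letter; case: odd.
  rewrite on_polygonC; apply: up xE _ _ _ => //; rewrite /letter ?oi //.
  by case: i oi {im} => //= i; case: odd.
case: xE => xE.
  apply: up xE _ _ _ => //; rewrite /letter ?oi // => /eqP ei.
  by move: m0 oi; rewrite -ei; case: i {im ei} => //= i _; case: odd.
have [i0|i0] := posnP i.
  by exists 1%N => //; left; rewrite xE i0.
rewrite on_polygonC; apply: down xE _; first by rewrite i0.
by case: i oi i0 {im} => //= i; rewrite /letter; case: odd.
Qed.

Lemma coset_polygon_exists s t m x : S s -> S t -> has_order (s * t) m ->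
  exists2 d, coset_polygon s t d m & on_polygon s t d m x.
Proof.
move=> Ss St ord; have [n [n1 nM]] := inversion_cocycle coxS.
have [d [dl dr dx]] := coset_min n1 nM x Ss St.
have ss := gen_mulss coxS Ss; have tt := gen_mulss coxS St.
have ordC : has_order (t * s) m.
  case: ord => m0 st1 ord; split=> // [|k km]; first exact: expgC1.
  by move/(expgC1 tt ss); apply: ord.
have pol : coset_polygon s t d m.
  have [m0 st1 _] := ord; split=> //.
  - exact: chain_top.
  - by move=> i; apply: (chain_asc n1 nM Ss St ord dl).
  - by move=> i; apply: (chain_asc n1 nM St Ss ordC dr).
  move=> i im; rewrite !chain_reflection //.
  by rewrite (expg_reflection_swap ss tt st1 im).
(* The induction principle from [coset_min] carries [on_polygon] from d to x. *)
exists d => //; apply: dx.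
- by move=> y; apply: on_polygonM.
- move=> y /on_polygonC ?; apply/on_polygonC.
  exact: on_polygonM (coset_polygonC pol) _.
by exists 0%N => //; left.
Qed.

End Coset.

(** * Linearity of words in operators *)

Lemma word_op_rcons (I V : Type) (T : I -> V -> V) l a v :
  word_op T (rcons l a) v = word_op T l (T a v).
Proof. by rewrite /word_op foldr_rcons. Qed.

Section LinearWord.
Local Open Scope ring_scope.
Variables (I : Type) (K : nzRingType) (V : lmodType K).
Variable T : I -> {linear V -> V}.

Lemma word_opZ l a v : word_op T l (a *: v) = a *: word_op T l v.
Proof. by elim: l => //= i l ->; rewrite linearZ. Qed.

Lemma word_opN l v : word_op T l (- v) = - word_op T l v.
Proof. by rewrite -!scaleN1r word_opZ. Qed.

Lemma word_op_sum (J : Type) (r : seq J) l (F : J -> V) :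
  word_op T l (\sum_(j <- r) F j) = \sum_(j <- r) word_op T l (F j).
Proof. by elim: l => //= i l ->; rewrite linear_sum. Qed.

End LinearWord.

(** * The operators on basis vectors and the braid relation *)

Section Action.
Local Open Scope ring_scope.
Variables (W : groupType) (S X : set W) (R : realType).
Hypothesis coxS : coxeter_system S.
Hypothesis ascX : ascent_compatible S X.

Notation CX := {malg R[i][set_type X]}.
Notation T := (fun s : W => pi_op S s : {linear CX -> CX}).

(** The value 0 outside X merges the two ascent cases of [pi_basis] into one formula. *)
Definition basis_or_0 (w : W) : CX := if insub w is Some x then << x >> else 0.
Notation E := basis_or_0.

Lemma basis_val (x : set_type X) : E (val x) = << x >>.
Proof. by rewrite /E valK. Qed.

Lemma basis_out w : ~ X w -> E w = 0.
Proof. by rewrite /E; case: insubP => // x /set_mem. Qed.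

Lemma pi_op_des s w : Des S w s -> T s (E w) = - E w.
Proof.
rewrite /E; case: insubP => [x _ <-|_] des; last by rewrite linear0 oppr0.
by rewrite /= pi_opU /pi_basis asboolT.
Qed.

Lemma pi_op_asc s w : X w -> ~ Des S w s -> T s (E w) = E (s * w)%g.
Proof.
move=> Xw; rewrite {1}/E; move: Xw; case: insubP => [x _ <- _ asc|]; last by move=> /negP wX /mem_set.
by rewrite /= pi_opU /pi_basis asboolF.
Qed.

Lemma malg_basis (a : R[i]) x : << a *g x >> = a *: E (val x) :> CX.
Proof. by rewrite basis_val; apply/malgP => y; rewrite mcoeffZ !mcoeffU mulr_natr. Qed.

Lemma pi_op_sqr s (v : CX) : S s -> T s (T s v) = - T s v.
Proof.
move=> Ss; rewrite -[LHS]/(word_op T [:: s; s] v) -[T s v]/(word_op T [:: s] v).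
rewrite [v]monalgE !word_op_sum -sumrN; apply: eq_bigr => x _.
rewrite malg_basis !word_opZ -scalerN; congr (_ *: _); rewrite /word_op /foldr.
have [des|asc] := pselect (Des S (val x) s).
  by rewrite !(pi_op_des des) linearN /= (pi_op_des des).
rewrite (pi_op_asc _ asc); last exact: set_valP.
(* [s * val x] has descent s, and [pi_op_des] also covers the case where it lies outside X. *)
by apply/pi_op_des/DesM.
Qed.

Lemma word_op_all_des k a b w : Des S w a -> Des S w b ->
  word_op T (alternating a b k) (E w) = (-1) ^+ k *: E w.
Proof.
elim: k a b => [|k IH] a b wa wb; first by rewrite scale1r.
rewrite [alternating _ _ _]/= word_op_rcons (pi_op_des wb) word_opN IH //.
by rewrite exprS mulN1r scaleNr.
Qed.

Definition chain_in s t d m i := forall j, (i <= j <= m)%N -> X (chain s t d j).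

Lemma polygon_des s t d m i : coset_polygon S s t d m -> (0 < i <= m)%N ->
  Des S (chain s t d i) (letter s t i.-1).
Proof.
move=> pol; case: i => // i im /=.
apply/DesM => //; last exact: (polygon_ascl pol).
exact: letter_gen (polygon_left pol) (polygon_right pol).
Qed.

(** The last edges of the two sides carry different letters, so both s and t are descents at the
    top. *)
Lemma polygon_top_des s t d m i : coset_polygon S s t d m ->
  Des S (chain s t d m) (letter s t i).
Proof.
move=> pol; have m0 := polygon_gt0 pol.
have desl : Des S (chain s t d m) (letter s t m.-1).
  by apply: (polygon_des pol); rewrite m0 /=.
have desr : Des S (chain s t d m) (letter t s m.-1).
  rewrite (polygon_top pol); apply: (polygon_des (coset_polygonC pol)).
  by rewrite m0 /=.
by move: desl desr; rewrite /letter; case: odd; case: odd.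
Qed.

(** The first m - i letters applied climb to the top, or give 0 for good on leaving X; each of the
    other k letters contributes a sign there. *)
Lemma word_op_climb s t d m i k : coset_polygon S s t d m -> (i <= m)%N ->
  word_op T (alternating (letter s t i.+1) (letter s t i) (m - i + k))
    (E (chain s t d i)) =
  if `[< chain_in s t d m i >] then (-1) ^+ k *: E (chain s t d m) else 0.
Proof.
move=> pol; move e : (m - i)%N => r im; elim: r i e im => [|r IH] i e im.
  have {im e}-> : i = m by apply/eqP; rewrite eqn_leq im -subn_eq0 e.
  rewrite word_op_all_des; try exact: polygon_top_des.
  case: asboolP => // mX; rewrite basis_out ?scaler0 // => Xm; apply: mX.
  by move=> j; rewrite -eqn_leq => /eqP <-.
rewrite addSn [alternating _ _ _]/= word_op_rcons.
have [Xi|nXi] := pselect (X (chain s t d i)); last first.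
  rewrite basis_out // linear0 asboolF; last first.
    by move/(_ i); rewrite leqnn im => /(_ isT).
  by elim: alternating => //= a l ->; rewrite linear0.
rewrite (pi_op_asc Xi); last by apply: (polygon_ascl pol); lia.
rewrite -[(_ * _)%g]/(chain s t d i.+1).
have -> : letter s t i = letter s t i.+2 by rewrite /letter /= negbK.
rewrite IH; [|lia|lia].
congr (if _ then _ else _); apply/asbool_equiv_eq; split=> Xj j /andP[ij jm].
  by move: ij; rewrite leq_eqVlt => /predU1P[<-//|ij]; apply: Xj; rewrite ij.
by apply: Xj; rewrite jm ltnW.
Qed.

(* The step of one side at height [i] is aligned with the step of the other at
   height [m.-1 - i], so the second side stays in [X] one step at a time. *)
Lemma chain_in_other_side s t d m : coset_polygon S s t d m ->
  chain_in s t d m 0 -> chain_in t s d m 0.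
Proof.
move=> pol Xl i /=; elim: i => [_|i IH im]; first exact: (Xl 0%N isT).
have Xi : X (chain t s d i) by apply: IH; apply: ltnW.
have Ss := polygon_left pol; have St := polygon_right pol.
set j := (m.-1 - i)%N; have jm : (j < m)%N by rewrite /j; lia.
have := ascX (Xl j (ltnW jm)) Xi (letter_gen j Ss St) (letter_gen i St Ss).
case.
  split; first by split; [exact: letter_gen|exact: (polygon_ascl pol)].
    by split; [exact: letter_gen|exact: (polygon_ascr pol)].
  by rewrite (polygon_refl pol jm) /j subKn //; lia.
by move=> + _; apply; apply: (Xl j.+1).
Qed.

Lemma word_op_braid s t d m i : coset_polygon S s t d m -> (i <= m)%N ->
  X (chain s t d i) ->
  word_op T (alternating s t m) (E (chain s t d i)) =
  word_op T (alternating t s m) (E (chain s t d i)).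
Proof.
move=> pol im Xi; case: (posnP i) => [->|i0].
  have /= := word_op_climb 0 pol (leq0n m).
  have /= := word_op_climb 0 (coset_polygonC pol) (leq0n m).
  rewrite !subn0 !addn0 => -> ->; rewrite (polygon_top pol).
  congr (if _ then _ else _); apply/asbool_equiv_eq.
  by split; apply: chain_in_other_side => //; apply: coset_polygonC.
(* Above the bottom, the words are sorted by whether the letter applied first is the ascent or the
   descent at height i. *)
suff H : word_op T (alternating (letter s t i.+1) (letter s t i) m)
           (E (chain s t d i)) =
         word_op T (alternating (letter s t i) (letter s t i.+1) m)
           (E (chain s t d i)).
  by move: H; rewrite /letter /=; case: odd.
have m0 := polygon_gt0 pol.
have des : Des S (chain s t d i) (letter s t i.+1).
  have := polygon_des pol; move=> /(_ i); rewrite i0 => /(_ im).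
  by case: i i0 {im Xi} => // i _ /=; rewrite /letter /= negbK.
rewrite -[m in RHS](prednK m0) [alternating _ _ m.-1.+1]/= word_op_rcons.
rewrite (pi_op_des des) word_opN.
rewrite -[m in LHS](subnK im) (word_op_climb _ pol im).
(* One sign is spent at once on the descent, leaving i - 1 for the top; the other word spends all
   its i signs there. *)
have -> : m.-1 = (m - i + i.-1)%N by lia.
rewrite (word_op_climb _ pol im); case: asboolP => _; last by rewrite oppr0.
by rewrite -[i in LHS](prednK i0) exprS mulN1r scaleNr.
Qed.

End Action.

Theorem theorem3p1 (W : groupType) (S : set W) (R : realType) (X : set W) :
  coxeter_system S ->
  ascent_compatible S X ->
  hecke0_action S
    (fun s : W => pi_op S s
       : {linear {malg R[i][set_type X]} -> {malg R[i][set_type X]}}).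
Proof.
move=> coxS ascX; split=> [s Ss v|s t m Ss St _ ord v]; first exact: pi_op_sqr.
rewrite [v]monalgE !word_op_sum; apply: eq_bigr => x _.
rewrite malg_basis !word_opZ; congr (_ *: _)%R.
have [d pol [i im xE]] := coset_polygon_exists coxS (val x) Ss St ord.
have Xx : X (val x) := set_valP x.
(* A vertex on the other side is handled by the mirrored polygon. *)
case: xE Xx => -> Xi; first exact: word_op_braid pol im Xi.
by apply/esym; apply: word_op_braid (coset_polygonC pol) im Xi.
Qed.
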